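(* Let $a, b$ be positive integers with $2 \leq a \leq b$. Then $\mathcal{G}_{\mathcal{R}}(a,b) \leq a+b-1$.
   Context: A position is an unordered pair $(a,b)$ of nonnegative integers (pile sizes). $\mathcal{R}$-Wythoff: a move either removes a positive number of tokens from the larger pile (or from either pile if both piles have equal size), or removes the same positive number of tokens from both piles. $\mathcal{G}_{\mathcal{R}}$ is the Sprague-Grundy function of $\mathcal{R}$-Wythoff: $\mathcal{G}_{\mathcal{R}}(p)=\mathrm{mex}\{\mathcal{G}_{\mathcal{R}}(q): q \text{ reachable from } p \text{ in one move}\}$, where $\mathrm{mex}(S)$ is the least nonnegative integer not in $S$ and $\mathrm{mex}\{\}=0$. *)

(* Defs.v *)
From mathcomp Require Import all_boot.

Set Implicit Arguments.
Unset Strict Implicit.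
Unset Printing Implicit Defensive.

Lemma mex_subproof (s : seq nat) : exists n, n \notin s.
Proof.
exists (\max_(i <- s) i).+1; apply/negP => h.
by have := @leq_bigmax_seq _ s xpredT id _ h isT; rewrite ltnn.
Qed.

Definition mex (s : seq nat) : nat := ex_minn (mex_subproof s).

Lemma mex_notin (s : seq nat) : mex s \notin s.
Proof. by rewrite /mex; case: ex_minnP. Qed.

Lemma mex_le (s : seq nat) (n : nat) : n \notin s -> mex s <= n.
Proof. by rewrite /mex; case: ex_minnP => m _ h /h. Qed.

Lemma eq_mex (s t : seq nat) : s =i t -> mex s = mex t.
Proof.
move=> st; apply/eqP; rewrite eqn_leq.
by rewrite !mex_le ?mex_notin // ?st -?st ?mex_notin // st mex_notin.
Qed.

(* An unordered pair of piles is represented by either of its two orderings;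
   the rules below are invariant under swapping the piles, and [grundyR_sym]
   shows that the Sprague-Grundy value does not depend on the ordering. *)
Definition position : Type := (nat * nat)%type.

Inductive moveR : position -> position -> Prop :=
| MoveFst a b k : 0 < k <= a -> b <= a -> moveR (a, b) (a - k, b)
| MoveSnd a b k : 0 < k <= b -> a <= b -> moveR (a, b) (a, b - k)
| MoveBoth a b k : 0 < k <= a -> k <= b -> moveR (a, b) (a - k, b - k).

Definition optionsR (p : position) : seq position :=
  let: (a, b) := p in
  (if b <= a then [seq (a - k, b) | k <- iota 1 a] else [::]) ++
  (if a <= b then [seq (a, b - k) | k <- iota 1 b] else [::]) ++
  [seq (a - k, b - k) | k <- iota 1 (minn a b)].

Lemma optionsRP (p q : position) : reflect (moveR p q) (q \in optionsR p).
Proof.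
apply: (iffP idP); last first.
  case=> a b k /andP[k0 ka] h; rewrite /optionsR !mem_cat.
  - by rewrite h map_f // mem_iota k0 add1n ltnS.
  - by rewrite h (map_f (fun k => (a, b - k))) ?orbT // mem_iota k0 add1n ltnS.
  - rewrite (map_f (fun k => (a - k, b - k))) ?orbT //.
    by rewrite mem_iota k0 add1n ltnS leq_min ka.
case: p => a b; rewrite /optionsR !mem_cat => /or3P[].
- case: ifP => // ba /mapP[k]; rewrite mem_iota add1n ltnS => hk ->.
  exact: MoveFst.
- case: ifP => // ab /mapP[k]; rewrite mem_iota add1n ltnS => hk ->.
  exact: MoveSnd.
- move=> /mapP[k]; rewrite mem_iota add1n ltnS leq_min => /and3P[k0 ka kb] ->.
  by apply: MoveBoth; rewrite ?k0.
Qed.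

(* Every move decreases the total number of tokens, so [p.1 + p.2 + 1] rounds of
   unfolding suffice from [p]; see [grundyRE]. *)
Fixpoint grundyR_rec (n : nat) (p : position) : nat :=
  if n is n'.+1 then mex [seq grundyR_rec n' q | q <- optionsR p] else 0.

Definition grundyR (a b : nat) : nat := grundyR_rec (a + b).+1 (a, b).

Lemma moveR_lt (p q : position) : moveR p q -> q.1 + q.2 < p.1 + p.2.
Proof.
case=> a b k /andP[k0 ka] h /=.
- by rewrite ltn_add2r ltn_subrL k0 (leq_trans k0 ka).
- by rewrite ltn_add2l ltn_subrL k0 (leq_trans k0 ka).
- rewrite -addSn leq_add ?leq_subr //.
  by rewrite ltn_subrL k0 (leq_trans k0 ka).
Qed.

Lemma grundyR_rec_stable (m n : nat) (p : position) :
  p.1 + p.2 < m -> p.1 + p.2 < n -> grundyR_rec m p = grundyR_rec n p.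
Proof.
elim: m n p => // m IH [//|n] p; rewrite !ltnS => pm pn /=.
congr mex; apply/eq_in_map => q /optionsRP /moveR_lt qp.
by apply: IH; [exact: leq_trans qp pm | exact: leq_trans qp pn].
Qed.

Lemma grundyRE (a b : nat) :
  grundyR a b = mex [seq grundyR q.1 q.2 | q <- optionsR (a, b)].
Proof.
rewrite {1}/grundyR; congr mex; apply/eq_in_map => -[c d].
move=> /optionsRP /moveR_lt /= h.
by apply: grundyR_rec_stable.
Qed.

Lemma moveR_swap (p q : position) : moveR p q -> moveR (p.2, p.1) (q.2, q.1).
Proof.
case=> a b k /andP[k0 ka] h /=.
- by apply: MoveSnd => //; rewrite k0.
- by apply: MoveFst => //; rewrite k0.
- by apply: MoveBoth => //; rewrite k0.
Qed.

Lemma grundyR_sym (a b : nat) : grundyR a b = grundyR b a.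
Proof.
suff H n : forall a b, a + b < n -> grundyR a b = grundyR b a by exact: H (leqnn _).
elim: n => // n IH {}a {}b; rewrite ltnS => abn.
rewrite !grundyRE; apply: eq_mex => x; apply/mapP/mapP => -[[c d] /optionsRP m ->].
- exists (d, c); first by apply/optionsRP; exact: moveR_swap m.
  by apply: IH; exact: leq_trans (moveR_lt m) abn.
- exists (d, c); first by apply/optionsRP; exact: moveR_swap m.
  by apply: IH; apply: leq_trans (moveR_lt m) _; rewrite /= addnC.
Qed.

(* Main.v *)
(** A move lowers the total number of tokens, so by induction every value is at
    most the total, and an option of (a, b) can reach the value a + b - 1 only if
    the move takes a single token. By induction on the total such an option falls
    short of a + b - 1 as well, except from (2, 2), where it is (1, 2), a position
    of value 0. Hence a + b - 1 is not the value of any option. *)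
Require Import Defs.
From mathcomp Require Import all_boot zify.

Set Implicit Arguments.
Unset Strict Implicit.
Unset Printing Implicit Defensive.

Lemma grundyR_le (a b n : nat) :
  (forall q, moveR (a, b) q -> grundyR q.1 q.2 <> n) -> grundyR a b <= n.
Proof.
move=> h; rewrite grundyRE; apply: mex_le; apply/mapP => -[q /optionsRP m e].
exact: h m (esym e).
Qed.

Lemma moveR_grundy_neq (a b : nat) (q : position) :
  moveR (a, b) q -> grundyR q.1 q.2 <> grundyR a b.
Proof.
move=> m e; have := mex_notin [seq grundyR q.1 q.2 | q <- optionsR (a, b)].
by rewrite -grundyRE -e => /mapP[]; exists q => //; apply/optionsRP.
Qed.

Lemma grundyR_le_total (a b : nat) : grundyR a b <= a + b.
Proof.
have [n] := ubnP (a + b); elim: n a b => // n IH a b abn.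
apply: grundyR_le => -[c d] /moveR_lt /= cd.
by have := IH c d; lia.
Qed.

(** The options (1, 1), (1, 0) and (0, 1) all have a move to (0, 0), of value 0, so none of them has
    value 0. *)
Lemma grundyR12 : grundyR 1 2 = 0.
Proof.
have G00 : grundyR 0 0 = 0 by have := grundyR_le_total 0 0; lia.
have pos a b : moveR (a, b) (0, 0) -> grundyR a b <> 0.
  by move=> /moveR_grundy_neq /=; rewrite G00 => h /esym.
apply/eqP; rewrite -leqn0; apply: grundyR_le => -[c d] /optionsRP.
rewrite !inE => /or3P[] /eqP[-> ->]; apply: pos; exact/optionsRP.
Qed.

Lemma grundyR_lt_total (a b : nat) : 1 < a -> 1 < b -> grundyR a b <= a + b - 1.
Proof.
have [n] := ubnP (a + b); elim: n a b => // n IH a b abn a1 b1.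
apply: grundyR_le => q m.
(* Here [c] is the pile just reduced. It was a largest pile and both piles were at least 2, so
   [c = 1] forces (2, 2) before the move and hence [d = 2]. *)
have single c d : c + d < a + b -> 0 < c -> 1 < d ->
    (c = 1 -> d = 2) -> grundyR c d <> a + b - 1.
  move=> cd c0 d1 c1d2; case: (eqVneq c 1) => [c1|c1].
    by rewrite c1 c1d2 // grundyR12; lia.
  by have := IH c d; lia.
have far c d : c + d < (a + b).-1 -> grundyR c d <> a + b - 1.
  by have := grundyR_le_total c d; lia.
inversion m as [a' b' k k0 ba|a' b' k k0 ab|a' b' k k0 kb]; subst => /=.
- case: (eqVneq k 1) => k1; last by apply: far; lia.
  by apply: single; lia.
- case: (eqVneq k 1) => k1; last by apply: far; lia.
  by rewrite grundyR_sym; apply: single; lia.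
(* A move on both piles takes at least two tokens. *)
- by apply: far; lia.
Qed.

Theorem theorem2p14 (a b : nat) (ha : 2 <= a) (hab : a <= b) :
  grundyR a b <= a + b - 1.
Proof. exact: grundyR_lt_total ha (leq_trans ha hab). Qed.
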